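(* Let $r>0$ and let $d$ be the Attouch–Wets metric on $\Gamma_0(\mathbb{R}^n)$, $$d(f,g)=\sum_{i=1}^\infty\frac1{2^i}\frac{\sup_{\|x\|\le i}|e_rf(x)-e_rg(x)|}{1+\sup_{\|x\|\le i}|e_rf(x)-e_rg(x)|}.$$ Let $U=\{f=q_A+c:\ A\in\mathcal{A},\ c\in\mathbb{R},\ f\in\Gamma_0(\mathbb{R}^n)\}$. Then: (i) $(U,d)$ is a complete metric space; (ii) $f\in U\Rightarrow f^*\in U$; (iii) $f\in U$, $\lambda>0\Rightarrow\lambda f\in U$; (iv) $f_1,f_2\in U\Rightarrow f_1+f_2\in U$; (v) $f_1,f_2\in U\Rightarrow f_1\,\square\,f_2\in U$.
   Context: $\Gamma_0(\mathbb{R}^n)$: proper convex lsc functions on $\mathbb{R}^n$. $e_rf(x)=\inf_y\{f(y)+\frac r2\|y-x\|^2\}$. $\mathcal{A}$ is the set of maximally monotone symmetric linear relations on $\mathbb{R}^n$ (linear relation: operator $\mathbb{R}^n\rightrightarrows\mathbb{R}^n$ with linear-subspace graph; symmetric: $\langle x,y^*\rangle=\langle y,x^*\rangle$ on the graph). $q_A(x)=\frac12\langle x,Ax\rangle$ on $\operatorname{dom}A$, $\infty$ elsewhere. $^*$ is the Fenchel conjugate and $\square$ is infimal convolution $(f_1\square f_2)(x)=\inf_y\{f_1(y)+f_2(x-y)\}$. *)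

(* Defs.v *)
From HB Require Import structures.
From mathcomp Require Import all_boot all_order all_algebra.
From mathcomp Require Import all_classical all_reals all_analysis.
Set Implicit Arguments. Unset Strict Implicit. Unset Printing Implicit Defensive.
Import Order.TTheory GRing.Theory Num.Theory.
Local Open Scope ring_scope.
Local Open Scope classical_set_scope.

Section Defs.
Context {R : realType} {n : nat}.
Local Notation vec := 'rV[R]_n.

Definition dotp (x y : vec) : R := \sum_(i < n) x ord0 i * y ord0 i.
Definition enorm (x : vec) : R := Num.sqrt (dotp x x).

Definition proper_fun (f : vec -> \bar R) : Prop :=
  (forall x, f x <> -oo%E) /\ (exists x, f x <> +oo%E).
Definition convex_fun (f : vec -> \bar R) : Prop :=
  forall (x y : vec) (t : R), 0 < t < 1 ->
    (f (t *: x + (1 - t) *: y)%R <= t%:E * f x + (1 - t)%:E * f y)%E.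
Definition lsc_fun (f : vec -> \bar R) : Prop :=
  forall (x : vec) (a : R), (a%:E < f x)%E ->
    exists2 delta : R, 0 < delta &
      forall y : vec, enorm (y - x) < delta -> (a%:E < f y)%E.
Definition Gamma0 (f : vec -> \bar R) : Prop :=
  [/\ proper_fun f, convex_fun f & lsc_fun f].

Definition moreau (r : R) (f : vec -> \bar R) (x : vec) : \bar R :=
  ereal_inf [set (f y + (r / 2 * enorm (y - x) ^+ 2)%:E)%E | y in [set: vec]].

Definition sup_dist (r : R) (f g : vec -> \bar R) (i : nat) : \bar R :=
  ereal_sup [set `|moreau r f x - moreau r g x|%E | x in [set x | enorm x <= i%:R]].

Definition ratio (s : \bar R) : R :=
  match s with EFin v => v / (1 + v) | _ => 1 end.

Definition aw_dist (r : R) (f g : vec -> \bar R) : R :=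
  limn (fun N : nat => \sum_(1 <= i < N) ((2%:R : R) ^- i * ratio (sup_dist r f g i))).

Definition linear_relation (G : set (vec * vec)) : Prop :=
  [/\ G (0, 0),
      (forall p q, G p -> G q -> G (p.1 + q.1, p.2 + q.2)) &
      (forall (a : R) p, G p -> G (a *: p.1, a *: p.2))].
Definition monotone_rel (G : set (vec * vec)) : Prop :=
  forall p q, G p -> G q -> 0 <= dotp (p.1 - q.1) (p.2 - q.2).
Definition max_monotone (G : set (vec * vec)) : Prop :=
  monotone_rel G /\
  (forall G' : set (vec * vec), monotone_rel G' -> G `<=` G' -> G' = G).
Definition symmetric_rel (G : set (vec * vec)) : Prop :=
  forall p q, G p -> G q -> dotp p.1 q.2 = dotp q.1 p.2.

Definition calA (G : set (vec * vec)) : Prop :=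
  [/\ linear_relation G, symmetric_rel G & max_monotone G].

(* q_A(x) = 1/2 <x, Ax> on dom A, +oo elsewhere (for A in calA the value
   <x,x*> does not depend on x* in Ax; we take the inf over x* in Ax,
   which is +oo when Ax is empty). *)
Definition qA (G : set (vec * vec)) (x : vec) : \bar R :=
  ereal_inf [set (dotp x y / 2)%:E | y in [set y | G (x, y)]].

Definition U_set (f : vec -> \bar R) : Prop :=
  exists (G : set (vec * vec)) (c : R),
    [/\ calA G, f = (fun x => qA G x + c%:E)%E & Gamma0 f].

Definition fconj (f : vec -> \bar R) (y : vec) : \bar R :=
  ereal_sup [set ((dotp x y)%:E - f x)%E | x in [set: vec]].

Definition fscale (l : R) (f : vec -> \bar R) (x : vec) : \bar R := (l%:E * f x)%E.
Definition fadd (f g : vec -> \bar R) (x : vec) : \bar R := (f x + g x)%E.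
Definition infconv (f g : vec -> \bar R) (x : vec) : \bar R :=
  ereal_inf [set (f y + g (x - y)%R)%E | y in [set: vec]].

End Defs.

(* Main.v *)
Require Import Defs.
From HB Require Import structures.
From mathcomp Require Import all_boot all_order all_algebra.
From mathcomp Require Import all_classical all_reals all_analysis.
From mathcomp Require Import ring lra.
Set Implicit Arguments. Unset Strict Implicit. Unset Printing Implicit Defensive.
Import Order.TTheory GRing.Theory Num.Theory numFieldNormedType.Exports.
Local Open Scope ring_scope.
Local Open Scope classical_set_scope.

(** A symmetric monotone linear relation [G] is maximally monotone exactly when
    every vector orthogonal to [G(0)] lies in its domain.  With this criterion
    inverses, positive multiples, sums and parallel sums of relations in [calA]
    stay in [calA], and these realise conjugation, scaling, addition and infimal
    convolution of the functions [q_A + c].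

    For completeness, Minty's theorem (here linear algebra) writes each [G] as
    [{(zJ, r(z - zJ))}] for a symmetric matrix [J] with [|zJ|^2 <= <zJ, z>], and
    the Moreau envelope of [q_G + c] is then the quadratic polynomial
    [x |-> r/2 <x, x - xJ> + c].  So the distance controls, and is controlled by,
    the entries of [J] and [c], and the conditions on [J] are closed. *)

(** * The inner product, and real polynomials that stay nonnegative *)

Section InnerProduct.
Context {R : realType} {n : nat}.
Implicit Types (x y z w : 'rV[R]_n) (a : R).

Lemma dotpE x y : dotp x y = (x *m y^T) 0 0.
Proof. by rewrite /dotp mxE; apply: eq_bigr => i _; rewrite mxE. Qed.

Lemma dotpC x y : dotp x y = dotp y x.
Proof. by rewrite /dotp; apply: eq_bigr => i _; rewrite mulrC. Qed.

Lemma dotpDl x y z : dotp (x + y) z = dotp x z + dotp y z.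
Proof. by rewrite !dotpE mulmxDl mxE. Qed.

Lemma dotpDr x y z : dotp z (x + y) = dotp z x + dotp z y.
Proof. by rewrite dotpC dotpDl !(dotpC z). Qed.

Lemma dotpZl a x y : dotp (a *: x) y = a * dotp x y.
Proof. by rewrite !dotpE -scalemxAl mxE. Qed.

Lemma dotpZr a x y : dotp x (a *: y) = a * dotp x y.
Proof. by rewrite dotpC dotpZl dotpC. Qed.

Lemma dotpNl x y : dotp (- x) y = - dotp x y.
Proof. by rewrite -scaleN1r dotpZl mulN1r. Qed.

Lemma dotpNr x y : dotp x (- y) = - dotp x y.
Proof. by rewrite dotpC dotpNl dotpC. Qed.

Lemma dotp0l x : dotp 0 x = 0.
Proof. by rewrite -[0](scale0r x) dotpZl mul0r. Qed.

Lemma dotp0r x : dotp x 0 = 0.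
Proof. by rewrite dotpC dotp0l. Qed.

Definition dotp_lin := (dotpDl, dotpDr, dotpNl, dotpNr, dotpZl, dotpZr, dotp0l, dotp0r).

Lemma dotpxx_ge0 x : 0 <= dotp x x.
Proof. by apply: sumr_ge0 => i _; rewrite -expr2 sqr_ge0. Qed.

Lemma dotpxx_eq0 x : dotp x x = 0 -> x = 0.
Proof.
move=> /eqP; rewrite /dotp psumr_eq0; last by move=> i _; rewrite -expr2 sqr_ge0.
move=> /allP h; apply/rowP => i; rewrite mxE.
by have := h i (mem_index_enum _); rewrite mulf_eq0 orbb => /eqP.
Qed.

Lemma sqr_enorm x : enorm x ^+ 2 = dotp x x.
Proof. by rewrite /enorm sqr_sqrtr ?dotpxx_ge0. Qed.

Lemma enorm0 : enorm (0 : 'rV[R]_n) = 0.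
Proof. by rewrite /enorm dotp0l sqrtr0. Qed.

Lemma enorm_coord x (i : 'I_n) : `|x 0 i| <= enorm x.
Proof.
rewrite -sqrtr_sqr /enorm ler_wsqrtr // /dotp (bigD1 i) //= -expr2 lerDl.
by apply: sumr_ge0 => j _; rewrite -expr2 sqr_ge0.
Qed.

(** A coordinatewise stand-in for Cauchy-Schwarz: what matters is a bound linear in [enorm x] with a
    constant depending on [v] alone. *)
Lemma dotp_le_enorm x v : `|dotp x v| <= enorm x * \sum_i `|v 0 i|.
Proof.
rewrite mulr_sumr; apply: le_trans (ler_norm_sum _ _ _) _.
by apply: ler_sum => i _; rewrite normrM ler_wpM2r // enorm_coord.
Qed.

Lemma dotp_mulmx x y (M : 'M[R]_n) : dotp (x *m M) y = dotp x (y *m M^T).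
Proof. by rewrite !dotpE trmx_mul trmxK mulmxA. Qed.

Lemma affine_ge0_slope (a b : R) : (forall t : R, 0 <= a + t * b) -> b = 0.
Proof.
move=> h; have [//|b0] := eqVneq b 0.
(* At this [t] the affine expression equals -1. *)
have := h (- (a + 1) / b); rewrite divfK //; lra.
Qed.

Lemma quadratic_ge0_slope (a b : R) :
  (forall t : R, 0 <= t ^+ 2 * a + t * b) -> b = 0.
Proof.
move=> h; have a0 : 0 <= a by have := h 1; have := h (-1); lra.
have [//|b0] := eqVneq b 0.
have a1 : 0 < a + 1 by lra.
(* The minimizer would be of order [- b / a]; the [+ 1] keeps the denominator positive when [a = 0],
   and the value is still negative. *)
have := h (- b / (a + 1)).
have -> : (- b / (a + 1)) ^+ 2 * a + - b / (a + 1) * b = - (b / (a + 1)) ^+ 2.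
  by field; lra.
by rewrite oppr_ge0 le_eqVlt ltNge sqr_ge0 orbF sqrf_eq0 mulf_eq0 (negbTE b0)
  invr_eq0 gt_eqF.
Qed.

End InnerProduct.

(** * Linear subspaces as row spaces, and double orthogonality *)

Section Subspaces.
Context {R : realType} {n : nat}.

Definition vsubspace (V : set 'rV[R]_n) : Prop :=
  [/\ V 0, (forall x y, V x -> V y -> V (x + y)) & (forall a x, V x -> V (a *: x))].

Lemma vsubspace_mulmx (V : set 'rV[R]_n) (m : nat) (M : 'M[R]_(m, n)) :
  vsubspace V -> (forall i, V (row i M)) -> forall u, V (u *m M).
Proof.
move=> [V0 VD VZ] hM u; rewrite mulmx_sum_row.
by elim/big_ind: _ => // i _; apply: VZ.
Qed.

(** Take [M] of maximal rank among the matrices with rows in [V]. Adjoining a vector of [V] cannot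
    raise the rank, so that vector already lies in the row space. *)
Lemma vsubspace_rowspace (V : set 'rV[R]_n) :
  vsubspace V -> exists M : 'M[R]_n, forall x, V x <-> (x <= M)%MS.
Proof.
move=> sV; pose P k := `[< exists M : 'M[R]_n, (forall i, V (row i M)) /\ \rank M = k >].
have P0 : exists k, P k.
  exists 0; apply/asboolP; exists 0; split; last by rewrite mxrank0.
  by move=> i; rewrite row0; case: sV.
have Pn k : P k -> (k <= n)%N.
  by move=> /asboolP[M [_ <-]]; exact: rank_leq_col.
case: (ex_maxnP P0 Pn) => k /asboolP[M [hM rM]] kmax; exists M => x; split; last first.
  by move=> /submxP[u ->]; exact: vsubspace_mulmx.
move=> Vx; pose N := (M + x)%MS.
have hN i : V (row i N).
  have : (row i N <= col_mx M x)%MS by rewrite -addsmxE row_sub.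
  move=> /submxP[u ->]; apply: vsubspace_mulmx => // j.
  by case: (split_ordP j) => l ->; rewrite ?rowKu ?rowKd // ord1 row_id.
have rN : (\rank N <= k)%N by apply: kmax; apply/asboolP; exists N.
have MN : (N <= M)%MS.
  by rewrite -(geq_leqif (mxrank_leqif_sup (addsmxSl M x))) rM.
exact: submx_trans (addsmxSr _ _) MN.
Qed.

(** The columns of the cokernel matrix of a basis matrix are orthogonal to [V], and a vector killed
    by all of them lies in the row space. *)
Lemma vsubspace_biorthogonal (V : set 'rV[R]_n) x : vsubspace V ->
  (forall w, (forall v, V v -> dotp v w = 0) -> dotp x w = 0) -> V x.
Proof.
move=> sV hx; have [M hM] := vsubspace_rowspace sV.
apply/hM; rewrite submxE; apply/eqP/rowP => j.
have E v : (v *m cokermx M) 0 j = dotp v (row j (cokermx M)^T).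
  by rewrite /dotp mxE; apply: eq_bigr => i _; rewrite !mxE.
rewrite E mxE; apply: hx => v /hM; rewrite submxE -E => /eqP ->.
by rewrite mxE.
Qed.

End Subspaces.

(** * Symmetric monotone linear relations: maximality and stability under operations *)

Section LinearRelations.
Context {R : realType} {n : nat}.
Implicit Types (G H : set ('rV[R]_n * 'rV[R]_n)) (x y u v w z : 'rV[R]_n).

(** Maximality in pointwise form: a pair monotonically related to all of [G] could be adjoined to
    it, so it is already there. *)
Lemma max_monotoneP G : max_monotone G <->
  monotone_rel G /\
  forall x y, (forall u v, G (u, v) -> 0 <= dotp (x - u) (y - v)) -> G (x, y).
Proof.
split=> -[mG hG]; split=> //.
  move=> x y hxy; rewrite -(hG (G `|` [set (x, y)])); [by right| |by left].
  move=> [a b] [c d] /= [Gp|[-> ->]] [Gq|[-> ->]].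
  - exact: (mG (a, b) (c, d)).
  - by have := hxy _ _ Gp; rewrite !dotp_lin; lra.
  - exact: hxy.
  - by rewrite !subrr dotp0l.
move=> G' mG' GG'; apply/seteqP; split=> // -[x y] G'xy; apply: hG => u v Guv.
by apply: (mG' (x, y) (u, v)) => //; apply: GG'.
Qed.

Section Linear.
Context {G : set ('rV[R]_n * 'rV[R]_n)}.
Context (lG : linear_relation G).

Lemma linrelD x y u v : G (x, y) -> G (u, v) -> G (x + u, y + v).
Proof. by case: lG => _ h _ Gp Gq; exact: (h _ _ Gp Gq). Qed.

Lemma linrelZ (a : R) x y : G (x, y) -> G (a *: x, a *: y).
Proof. by case: lG => _ _ h Gp; exact: (h a _ Gp). Qed.

Lemma linrelB x y u v : G (x, y) -> G (u, v) -> G (x - u, y - v).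
Proof.
by move=> Gp Gq; rewrite -!(scaleN1r u) -(scaleN1r v); apply: linrelD => //; apply: linrelZ.
Qed.

Lemma linrel0 : G (0, 0). Proof. by case: lG. Qed.

Lemma linear_monotone : (forall x y, G (x, y) -> 0 <= dotp x y) -> monotone_rel G.
Proof. by move=> h [x y] [u v] Gp Gq; apply: h; apply: linrelB. Qed.

Lemma vsubspace_dom : vsubspace [set x | exists y, G (x, y)].
Proof.
split=> /=.
- by exists (0 : 'rV[R]_n); exact: linrel0.
- by move=> x u [y Gp] [v Gq]; exists (y + v); apply: linrelD.
- by move=> a x [y Gp]; exists (a *: y); apply: linrelZ.
Qed.

Lemma vsubspace_image0 : vsubspace [set y | G (0, y)].
Proof.
split=> /=.
- exact: linrel0.
- by move=> x y Gp Gq; rewrite -[0]addr0; apply: linrelD.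
- by move=> a x Gp; rewrite -(scaler0 _ a); apply: linrelZ.
Qed.

End Linear.

(** Sufficiency of the domain criterion. Testing a related pair [(x, y)] against multiples of
    [(0, v)] puts [x] in the domain, with some image [w]. Testing it against [(x, w)] plus multiples
    of [(u, v)] then makes [y - w] orthogonal to every [u] orthogonal to [G(0)], so double
    orthogonality gives [y - w] in [G(0)]. *)
Lemma calA_intro G : linear_relation G ->
  (forall x y u v, G (x, y) -> G (u, v) -> dotp x v = dotp u y) ->
  (forall x y, G (x, y) -> 0 <= dotp x y) ->
  (forall x, (forall y, G (0, y) -> dotp x y = 0) -> exists y, G (x, y)) ->
  calA G.
Proof.
move=> lG sG pG dG; split=> //; first by move=> [x y] [u v]; exact: sG.
apply/max_monotoneP; split; first exact: linear_monotone.
move=> x y hxy.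
have [w Gxw] : exists w, G (x, w).
  apply: dG => v Gv; apply/eqP; rewrite -oppr_eq0; apply/eqP.
  apply: (@affine_ge0_slope _ (dotp x y)) => t.
  have := hxy _ _ (linrelZ lG t Gv); rewrite scaler0 !dotp_lin; lra.
suff G0 : G (0, y - w).
  by have := linrelD lG Gxw G0; rewrite addr0 addrC subrK.
apply: (vsubspace_biorthogonal (vsubspace_image0 lG)) => u hu.
have [v Guv] : exists v, G (u, v) by apply: dG => v /hu; rewrite dotpC.
rewrite dotpC; apply/eqP; rewrite -oppr_eq0; apply/eqP.
apply: (@quadratic_ge0_slope _ (dotp u v)) => t.
have := hxy _ _ (linrelD lG Gxw (linrelZ lG t Guv)).
by congr (0 <= _); rewrite !dotp_lin; ring.
Qed.

Section CalA.
Context {G : set ('rV[R]_n * 'rV[R]_n)}.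
Context (AG : calA G).

Lemma calA_linear : linear_relation G. Proof. by case: AG. Qed.
Let lG := calA_linear.

Lemma calA_sym x y u v : G (x, y) -> G (u, v) -> dotp x v = dotp u y.
Proof. by case: AG => _ sG _; exact: (sG (x, y) (u, v)). Qed.

Lemma calA_mono x y u v : G (x, y) -> G (u, v) -> 0 <= dotp (x - u) (y - v).
Proof. by case: AG => _ _ [mG _]; exact: (mG (x, y) (u, v)). Qed.

Lemma calA_ge0 x y : G (x, y) -> 0 <= dotp x y.
Proof. by move=> Gp; have := calA_mono Gp (linrel0 lG); rewrite !subr0. Qed.

Lemma calA_max x y :
  (forall u v, G (u, v) -> 0 <= dotp (x - u) (y - v)) -> G (x, y).
Proof. by case: AG => _ _ /max_monotoneP[_]; exact. Qed.

(** For such [y] the monotonicity test of [(0, y)] against [(u, v)] reduces to [<u, v> >= 0]. *)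
Lemma calA_image0 y : (forall u v, G (u, v) -> dotp u y = 0) -> G (0, y).
Proof.
move=> h; apply: calA_max => u v Guv; have := calA_ge0 Guv.
by rewrite !dotp_lin (h _ _ Guv); lra.
Qed.

Lemma calA_image0_orth x y w : G (x, y) -> G (0, w) -> dotp x w = 0.
Proof. by move=> Gp /(calA_sym Gp) ->; rewrite dotp0l. Qed.

(** Necessity of the domain criterion: [G(0)] contains the orthogonal complement of the domain, so
    [x] is doubly orthogonal to the domain. *)
Lemma calA_dom x : (forall y, G (0, y) -> dotp x y = 0) -> exists y, G (x, y).
Proof.
move=> h; apply: (vsubspace_biorthogonal (vsubspace_dom lG)) => w hw.
by apply: h; apply: calA_image0 => u v Guv; apply: hw; exists v.
Qed.

(** An isotropic vector of a semidefinite form lies in its radical. The two cross terms agree by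
    symmetry, whence the factor [t / 2] in the test pair. *)
Lemma calA_isotropic x y : G (x, y) -> dotp x y = 0 -> G (0, y).
Proof.
move=> Gp xy0; apply: calA_image0 => u v Guv.
apply: (@affine_ge0_slope _ (dotp u v)) => t.
have := calA_ge0 (linrelD lG Guv (linrelZ lG (t / 2) Gp)).
rewrite !dotp_lin xy0 (calA_sym Gp Guv); lra.
Qed.

End CalA.

Definition rel_inv G := [set p : 'rV[R]_n * 'rV[R]_n | G (p.2, p.1)].

Lemma calA_inv G : calA G -> calA (rel_inv G).
Proof.
move=> AG; have lG := calA_linear AG; split.
- split=> /=; first exact: (linrel0 lG).
  + by move=> p q Gp Gq; exact: (linrelD lG Gp Gq).
  + by move=> a p Gp; exact: (linrelZ lG a Gp).
- by move=> [x y] [u v] /= Gp Gq; rewrite dotpC -(calA_sym AG Gp Gq) dotpC.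
- apply/max_monotoneP; split.
    by move=> [x y] [u v] /= Gp Gq; rewrite dotpC; exact: (calA_mono AG).
  move=> x y h; apply: (calA_max AG) => u v Guv; rewrite dotpC; exact: h.
Qed.

Definition rel_scale (l : R) G := [set p : 'rV[R]_n * 'rV[R]_n | G (p.1, l^-1 *: p.2)].

Lemma calA_scale l G : 0 < l -> calA G -> calA (rel_scale l G).
Proof.
move=> l0 AG; have lG := calA_linear AG.
have li0 : 0 < l^-1 by rewrite invr_gt0.
have lK y : l *: (l^-1 *: y) = y by rewrite scalerA divff ?gt_eqF // scale1r.
rewrite /rel_scale; apply: calA_intro.
- split=> /=; first by rewrite scaler0; exact: (linrel0 lG).
  + by move=> p q Gp Gq; rewrite scalerDr; exact: linrelD.
  + by move=> a p Gp; rewrite scalerA mulrC -scalerA; exact: linrelZ.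
- move=> x y u v /= Gp Gq; have := calA_sym AG Gp Gq; rewrite !dotpZr.
  by apply: mulfI; rewrite gt_eqF.
- by move=> x y /= Gp; rewrite -(lK y) dotpZr mulr_ge0 ?(ltW l0) // (calA_ge0 AG).
- move=> x h; have [y Gxy] : exists y, G (x, y).
    apply: (calA_dom AG) => y Gy; have := h (l *: y).
    rewrite /= scalerA mulVf ?gt_eqF // scale1r dotpZr => /(_ Gy) /eqP.
    by rewrite mulf_eq0 gt_eqF //= => /eqP.
  by exists (l *: y); rewrite /= scalerA mulVf ?gt_eqF // scale1r.
Qed.

Definition rel_add G H :=
  [set p : 'rV[R]_n * 'rV[R]_n | exists y z, [/\ G (p.1, y), H (p.1, z) & p.2 = y + z]].

(** For the domain criterion: [(G + H)(0)] contains both [G(0)] and [H(0)], so a vector orthogonal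
    to it lies in both domains. *)
Lemma calA_add G H : calA G -> calA H -> calA (rel_add G H).
Proof.
move=> AG AH; have lG := calA_linear AG; have lH := calA_linear AH.
apply: calA_intro.
- split=> /=.
  + by exists 0, 0; split; rewrite ?addr0 //; exact: linrel0.
  + move=> p q [y1 [z1 [Gp Hp ->]]] [y2 [z2 [Gq Hq ->]]].
    exists (y1 + y2), (z1 + z2); split=> /=; last by rewrite addrACA.
      exact: (linrelD lG Gp Gq).
    exact: (linrelD lH Hp Hq).
  + move=> a p [y1 [z1 [Gp Hp ->]]].
    exists (a *: y1), (a *: z1); split=> /=; last by rewrite scalerDr.
      exact: (linrelZ lG a Gp).
    exact: (linrelZ lH a Hp).
- move=> x y u v [/= y1 [z1 [Gp Hp ->]]] [/= y2 [z2 [Gq Hq ->]]].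
  by rewrite !dotpDr (calA_sym AG Gp Gq) (calA_sym AH Hp Hq).
- move=> x y [/= y1 [z1 [Gp Hp ->]]].
  by rewrite dotpDr; apply: addr_ge0; [exact: (calA_ge0 AG Gp)|exact: (calA_ge0 AH Hp)].
- move=> x h.
  have [y Gxy] : exists y, G (x, y).
    apply: (calA_dom AG) => y Gy; apply: h; exists y, 0.
    by split; rewrite ?addr0 //; exact: linrel0.
  have [z Hxz] : exists z, H (x, z).
    apply: (calA_dom AH) => z Hz; apply: h; exists 0, z.
    by split; rewrite ?add0r //; exact: linrel0.
  by exists (y + z), y, z.
Qed.

(** Unfolded, [(x, y)] belongs to the parallel sum when [x = a + b] with [y] in both [G(a)] and
    [H(b)]. *)
Definition rel_parallel G H := rel_inv (rel_add (rel_inv G) (rel_inv H)).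

Lemma calA_parallel G H : calA G -> calA H -> calA (rel_parallel G H).
Proof. by move=> AG AH; apply/calA_inv/calA_add; apply: calA_inv. Qed.

(** Here [0 = u + v] with [y] an image of both, so [<u, y>] and [<v, y>] are nonnegative with sum
    zero. Both vanish, and isotropy applies. *)
Lemma parallel_image0 G H y : calA G -> calA H ->
  rel_parallel G H (0, y) -> G (0, y) /\ H (0, y).
Proof.
move=> AG AH [/= u [v [Gu Hv /esym uv0]]].
have uv : dotp u y + dotp v y = 0 by rewrite -dotpDl uv0 dotp0l.
have := calA_ge0 AG Gu; have := calA_ge0 AH Hv => v0 u0.
by split; [apply: (calA_isotropic AG Gu)|apply: (calA_isotropic AH Hv)]; lra.
Qed.

(** By contraposition, outside the domain of the parallel sum every splitting in the infimal
    convolution has an infinite term. *)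
Lemma parallel_dom G H x y u v : calA G -> calA H -> G (x, y) -> H (u, v) ->
  exists w, rel_parallel G H (x + u, w).
Proof.
move=> AG AH Gp Hq; apply: (calA_dom (calA_parallel AG AH)) => w.
move=> /(parallel_image0 AG AH) [Gw Hw].
by rewrite dotpDl (calA_image0_orth AG Gp Gw) (calA_image0_orth AH Hq Hw) addr0.
Qed.

End LinearRelations.

(** * The functions [q_A + c] and the four operations on them *)

Section QuadraticForms.
Context {R : realType} {n : nat}.
Implicit Types (G H : set ('rV[R]_n * 'rV[R]_n)) (x y u v w z : 'rV[R]_n) (c : R).

(** Two images of [x] differ by an element of [G(0)], which is orthogonal to [x]; the infimum is
    over a single value. *)
Lemma qA_in G x y : calA G -> G (x, y) -> qA G x = (dotp x y / 2)%:E.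
Proof.
move=> AG Gxy; rewrite /qA [X in ereal_inf X](_ : _ = [set (dotp x y / 2)%:E]) ?ereal_inf1 //.
apply/seteqP; split=> [_ [z /= Gxz <-]|_ ->]; last by exists y.
congr (_ / 2)%:E; have := linrelB (calA_linear AG) Gxz Gxy; rewrite subrr.
by move=> /(calA_image0_orth AG Gxz); rewrite !dotp_lin => /eqP; rewrite subr_eq0 => /eqP.
Qed.

Lemma qA_out G x : ~ (exists y, G (x, y)) -> qA G x = +oo%E.
Proof.
move=> h; rewrite /qA [X in ereal_inf X](_ : _ = set0) ?ereal_inf0 //.
by apply/seteqP; split=> // t [y Gxy _]; case: h; exists y.
Qed.

Lemma qA_spec G x : calA G ->
  (exists2 y, G (x, y) & qA G x = (dotp x y / 2)%:E) \/
  (~ (exists y, G (x, y)) /\ qA G x = +oo%E).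
Proof.
move=> AG; have [[y Gxy]|nG] := pselect (exists y, G (x, y)).
  by left; exists y => //; exact: qA_in.
by right; split=> //; exact: qA_out.
Qed.

(** The subgradient inequality at [u] with slope [v]. It is the source of every lower bound on [qA]
    below. *)
Lemma qA_ge_affine G x u v : calA G -> G (u, v) ->
  ((dotp x v - dotp u v / 2)%:E <= qA G x)%E.
Proof.
move=> AG Guv; have [[y Gxy ->]|[_ ->]] := qA_spec x AG; last exact: leey.
rewrite lee_fin; have := calA_mono AG Gxy Guv; have := calA_sym AG Gxy Guv.
rewrite !dotp_lin; lra.
Qed.

(** [qA G] is the supremum of its affine minorants. Off the domain some [w] in [G(0)] is not
    orthogonal to [x], and the multiple chosen gives a minorant with value [a + 1] at [x]. *)
Lemma qA_gt_affine G x (a : R) : calA G -> (a%:E < qA G x)%E ->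
  exists u v, G (u, v) /\ a < dotp x v - dotp u v / 2.
Proof.
move=> AG; have [[y Gxy ->]|[nG _ _]] := qA_spec x AG.
  by rewrite lte_fin => h; exists x, y; split=> //; lra.
have [w [Gw xw]] : exists w, G (0, w) /\ dotp x w != 0.
  apply: contrapT => h; apply: nG; apply: (calA_dom AG) => w Gw.
  by apply/eqP; apply: contrapT => /negP xw; apply: h; exists w.
exists 0, (((a + 1) / dotp x w) *: w); split.
  by have := linrelZ (calA_linear AG) ((a + 1) / dotp x w) Gw; rewrite scaler0.
by rewrite !dotp_lin divfK //; lra.
Qed.

Lemma qA_lsc G : calA G -> lsc_fun (qA G).
Proof.
move=> AG x a /(qA_gt_affine AG)[u [v [Guv axv]]].
set b := dotp x v - dotp u v / 2 in axv.
pose m := \sum_i `|v 0 i|.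
have m0 : 0 <= m by apply: sumr_ge0.
(* The minorant has Lipschitz constant at most [m]; the [+ 1] covers [v = 0]. *)
exists ((b - a) / (m + 1)) => [|y yx]; first by rewrite divr_gt0; lra.
apply: lt_le_trans (qA_ge_affine y AG Guv); rewrite lte_fin.
have := dotp_le_enorm (y - x) v; rewrite -/m ler_norml => /andP[h _].
move: yx; rewrite ltr_pdivlMr; last lra.
have : 0 <= enorm (y - x) by apply: sqrtr_ge0.
move: h; rewrite !dotp_lin /b; nra.
Qed.

Lemma qA_convex G : calA G -> convex_fun (qA G).
Proof.
move=> AG x u t /andP[t0 t1].
have q0 z : (0 <= qA G z)%E.
  have := qA_ge_affine z AG (linrel0 (calA_linear AG)).
  by rewrite !dotp_lin mul0r subrr.
have [[y Gxy ->]|[_ ->]] := qA_spec x AG; last first.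
  rewrite gt0_muley ?lte_fin // addye ?leey //.
  rewrite gt_eqF //; apply: (@lt_le_trans _ _ 0%E); first exact: ltNyr.
  by apply: mule_ge0 => //; rewrite lee_fin; lra.
have [[v Guv ->]|[_ ->]] := qA_spec u AG; last first.
  by rewrite gt0_muley ?lte_fin ?subr_gt0 // addey ?leey // -EFinM.
have lG := calA_linear AG.
rewrite (qA_in AG (linrelD lG (linrelZ lG t Gxy) (linrelZ lG (1 - t) Guv))).
rewrite -!EFinM -EFinD lee_fin.
have := calA_mono AG Gxy Guv; have := calA_sym AG Gxy Guv.
rewrite !dotp_lin => -> h.
(* The convexity defect is exactly half of this product, whose last factor is [<x - u, y - v>]. *)
have : 0 <= t * (1 - t) * (dotp x y + - dotp u y + (- dotp u y - - dotp u v)).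
  by rewrite !mulr_ge0 //; lra.
lra.
Qed.

Lemma Gamma0_addc (f : 'rV[R]_n -> \bar R) c : Gamma0 f ->
  Gamma0 (fun x => f x + c%:E)%E.
Proof.
move=> [[f1 [x0 f2]] fc fl]; split.
- split; first by move=> x /=; move: (f1 x); case: (f x).
  by exists x0; move: f2; case: (f x0).
- move=> x y t t01; have := fc x y t t01.
  move: (f1 (t *: x + (1 - t) *: y)%R); move: t01 => /andP[t0 t1].
  have t1' : 0 < 1 - t by lra.
  move: (f1 x) (f1 y).
  case: (f x) => [a| |] //; case: (f y) => [b| |] //; case: (f _) => [d| |] // _ _ _;
    rewrite /= ?gt0_muley ?lte_fin //= -?EFinM -?EFinD ?leey ?lee_fin //=; lra.
- move=> x a h; have : ((a - c)%:E < f x)%E by rewrite EFinB lteBlDr.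
  move=> /fl[d d0 hd]; exists d => // y /hd.
  by rewrite EFinB lteBlDr.
Qed.

Lemma qA_Gamma0 G : calA G -> Gamma0 (qA G).
Proof.
move=> AG; split; [split|exact: qA_convex|exact: qA_lsc].
  by move=> x; have [[y _ ->]|[_ ->]] := qA_spec x AG.
by exists 0; rewrite (qA_in AG (linrel0 (calA_linear AG))).
Qed.

Lemma U_set_qA G c : calA G -> U_set (fun x => qA G x + c%:E)%E.
Proof. by move=> AG; exists G, c; split=> //; apply/Gamma0_addc/qA_Gamma0. Qed.

(** If [y] is an image of some [x], the minorant of slope [y] touches [qA G] at [x] and the supremum
    is attained there. Otherwise the kernel of [G] contains a vector not orthogonal to [y], along
    which the supremum is infinite. *)
Lemma fconj_qA G c : calA G ->
  fconj (fun x => qA G x + c%:E)%E = (fun y => qA (rel_inv G) y + (- c)%:E)%E.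
Proof.
move=> AG; apply/funext => y; rewrite /fconj; have AI := calA_inv AG.
have [[x Gxy ->]|[nG ->]] := qA_spec y AI.
  rewrite -EFinD; apply/eqP; rewrite eq_le; apply/andP; split.
    apply: ge_ereal_sup => _ [u _ <-].
    have := qA_ge_affine u AG Gxy; have [[v _ ->]|[_ ->]] := qA_spec u AG;
      last by rewrite addye // leNye.
    by rewrite -(EFinD _ c) -EFinB !lee_fin [dotp y x]dotpC; lra.
  apply: ereal_sup_ubound; exists x => //; rewrite (qA_in AG Gxy).
  by rewrite -(EFinD _ c) -EFinB [dotp y x]dotpC; congr (_%:E); field.
rewrite addye //.
have [x [Gx xy]] : exists x, G (x, 0) /\ dotp y x != 0.
  apply: contrapT => h; apply: nG; apply: (calA_dom AI) => x Gx.
  by apply/eqP; apply: contrapT => /negP xw; apply: h; exists x.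
apply/eqyP => A A0; apply: ereal_sup_ubound.
have Gt := linrelZ (calA_linear AG) ((A + c) / dotp y x) Gx.
(* The form vanishes on the kernel, so this multiple gives the value [A] exactly. *)
exists (((A + c) / dotp y x) *: x) => //.
rewrite (qA_in AG Gt) scaler0 dotp0r mul0r add0e dotpZl (dotpC x) divfK //.
by rewrite -EFinB; congr (_%:E); ring.
Qed.

Lemma fscale_qA G c l : 0 < l -> calA G ->
  fscale l (fun x => qA G x + c%:E)%E = (fun x => qA (rel_scale l G) x + (l * c)%:E)%E.
Proof.
move=> l0 AG; apply/funext => x; rewrite /fscale.
have lK y : l^-1 *: (l *: y) = y by rewrite scalerA mulVf ?gt_eqF // scale1r.
have [[y Gxy ->]|[nG ->]] := qA_spec x AG.
  have Gl : rel_scale l G (x, l *: y) by rewrite /rel_scale /= lK.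
  rewrite (qA_in (calA_scale l0 AG) Gl) -!EFinD -EFinM dotpZr; congr (_%:E); ring.
rewrite qA_out; first by rewrite !addye // gt0_muley ?lte_fin.
by move=> [y Gy]; apply: nG; exists (l^-1 *: y).
Qed.

Lemma fadd_qA G H c d : calA G -> calA H ->
  fadd (fun x => qA G x + c%:E)%E (fun x => qA H x + d%:E)%E =
  (fun x => qA (rel_add G H) x + (c + d)%:E)%E.
Proof.
move=> AG AH; apply/funext => x; rewrite /fadd.
have [[y Gxy ->]|[nG ->]] := qA_spec x AG; last first.
  rewrite (@qA_out (rel_add G H)); last by move=> [w [y [z [Gy _ _]]]]; apply: nG; exists y.
  by have [[z _ ->]|[_ ->]] := qA_spec x AH; rewrite !addye.
have [[z Hxz ->]|[nH ->]] := qA_spec x AH; last first.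
  rewrite qA_out; first by rewrite !addye.
  by move=> [w [y' [z [_ Hz _]]]]; apply: nH; exists z.
have Ga : rel_add G H (x, y + z) by exists y, z.
by rewrite (qA_in (calA_add AG AH) Ga) -!EFinD dotpDr; congr (_%:E); field.
Qed.

(** The splitting [x = a + b] from the parallel sum attains the infimum. The minorants of [qA G] at
    [a] and [qA H] at [b] share the slope [y], so their sum does not depend on the competing
    splitting. *)
Lemma infconv_qA G H c d : calA G -> calA H ->
  infconv (fun x => qA G x + c%:E)%E (fun x => qA H x + d%:E)%E =
  (fun x => qA (rel_parallel G H) x + (c + d)%:E)%E.
Proof.
move=> AG AH; have AP := calA_parallel AG AH; apply/funext => x; rewrite /infconv.
have [[y Py ->]|[nP ->]] := qA_spec x AP; last first.
  rewrite addye //; apply/eqP; rewrite eq_le leey; apply: le_ereal_inf_tmp => _ [u _ <-].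
  have [[y Gu ->]|[_ ->]] := qA_spec u AG; last first.
    by have [[z _ ->]|[_ ->]] := qA_spec (x - u) AH.
  have [[z Hu ->]|[_ ->]] := qA_spec (x - u) AH; last by [].
  by exfalso; apply: nP; have := parallel_dom AG AH Gu Hu; rewrite addrC subrK.
case: Py => /= a [b [Ga Hb xab]].
apply/eqP; rewrite eq_le; apply/andP; split.
  apply: ereal_inf_lbound; exists a => //.
  have -> : x - a = b by rewrite xab addrC addKr.
  by rewrite (qA_in AG Ga) (qA_in AH Hb) -!EFinD xab dotpDl; congr (_%:E); field.
apply: le_ereal_inf_tmp => _ [u _ <-].
have Gu := qA_ge_affine u AG Ga; have Hu := qA_ge_affine (x - u) AH Hb.
apply: le_trans (leeD (leeD Gu (lexx c%:E)) (leeD Hu (lexx d%:E))).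
by rewrite -!EFinD lee_fin xab !dotp_lin; lra.
Qed.

End QuadraticForms.

(** * Resolvent matrices and Moreau envelopes *)

Section Resolvents.
Context {R : realType} {n : nat}.
Implicit Types (G : set ('rV[R]_n * 'rV[R]_n)) (x y u v w z : 'rV[R]_n) (c r : R)
  (J : 'M[R]_n).

(* Firm nonexpansiveness of [J], i.e. [0 <= J <= 1]. *)
Definition firm J : Prop :=
  J^T = J /\ forall z, dotp (z *m J) (z *m J) <= dotp (z *m J) z.

(** The relation with resolvent [(1 + G / r)^-1 = J]. Stating it as an equation also covers singular
    [J], where the inverse of [J] is multivalued. *)
Definition resolvent_rel r J :=
  [set p : 'rV[R]_n * 'rV[R]_n | p.1 = (p.1 + r^-1 *: p.2) *m J].

Lemma dotp_delta x (j : 'I_n) : dotp x (delta_mx 0 j) = x 0 j.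
Proof.
rewrite /dotp (bigD1 j) //= mxE !eqxx mulr1 big1 ?addr0 // => i ij.
by rewrite mxE (negbTE ij) andbF mulr0.
Qed.

Lemma resolvent_relE r J x y : r != 0 ->
  resolvent_rel r J (x, y) <-> exists z, x = z *m J /\ y = r *: (z - z *m J).
Proof.
move=> r0; rewrite /resolvent_rel /=; split=> [h|[z [-> ->]]]; last first.
  by rewrite scalerA mulVf // scale1r addrC subrK.
exists (x + r^-1 *: y); split=> //; rewrite -h addrC addKr.
by rewrite scalerA divff // scale1r.
Qed.

(** The inner product is [- r |x - w|^2]; this makes resolvents of monotone relations
    single-valued. *)
Lemma resolvent_unique r x w z : 0 < r ->
  0 <= dotp (x - w) (r *: (z - x) - r *: (z - w)) -> x = w.
Proof.
move=> r0; have -> : r *: (z - x) - r *: (z - w) = - (r *: (x - w)).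
  by rewrite -scalerBr -scalerN opprB [z - x + _]addrC addrA subrK opprB.
rewrite dotpNr dotpZr oppr_ge0 pmulr_rle0 // => d0.
apply/eqP; rewrite -subr_eq0; apply/eqP.
by apply: dotpxx_eq0; apply/eqP; rewrite eq_le d0 dotpxx_ge0.
Qed.

(** Maximality holds because the resolvent is defined everywhere: a related pair [(x, y)] is
    compared with the point of the relation having the same [z = x + y / r]. *)
Lemma calA_resolvent_rel r J : 0 < r -> firm J -> calA (resolvent_rel r J).
Proof.
move=> r0 [sJ fJ]; have rN0 : r != 0 by rewrite gt_eqF.
split.
- rewrite /resolvent_rel; split=> /=.
  + by rewrite scaler0 addr0 mul0mx.
  + by move=> p q {1}-> {1}->; rewrite -mulmxDl scalerDr addrACA.
  + by move=> a p {1}->; rewrite scalemxAl scalerDr scalerA mulrC -scalerA.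
- move=> [x y] [u v] /(resolvent_relE _ _ _ rN0)[z [-> ->]].
  move=> /(resolvent_relE _ _ _ rN0)[w [-> ->]] /=.
  rewrite !dotp_lin (dotpC (z *m J) (w *m J)); congr (_ * (_ - _)).
  by rewrite dotp_mulmx sJ dotpC.
- apply/max_monotoneP; split.
    move=> [x y] [u v] /(resolvent_relE _ _ _ rN0)[z [-> ->]].
    move=> /(resolvent_relE _ _ _ rN0)[w [-> ->]] /=.
    rewrite -scalerBr dotpZr mulr_ge0 ?(ltW r0) //.
    have := fJ (z - w); rewrite mulmxBl !dotp_lin; lra.
  move=> x y h; pose z := x + r^-1 *: y.
  have yE : y = r *: (z - x).
    by rewrite /z addrC addKr scalerA divff // scale1r.
  have Gz : resolvent_rel r J (z *m J, r *: (z - z *m J)).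
    by apply/resolvent_relE => //; exists z.
  by have := h _ _ Gz; rewrite {1}yE => /(resolvent_unique r0).
Qed.

Lemma calA_resolvent r G z : 0 < r -> calA G -> exists x, G (x, r *: (z - x)).
Proof.
move=> r0 AG; have lG := calA_linear AG.
pose S := [set s : 'rV[R]_n | exists x y, G (x, y) /\ s = r *: x + y].
have sS : vsubspace S.
  split.
  - by exists 0, 0; split; [exact: linrel0|rewrite scaler0 addr0].
  - move=> _ _ [x [y [Gp ->]]] [u [v [Gq ->]]]; exists (x + u), (y + v).
    by split; [exact: linrelD|rewrite scalerDr addrACA].
  - move=> a _ [x [y [Gp ->]]]; exists (a *: x), (a *: y).
    by split; [exact: linrelZ|rewrite scalerDr !scalerA mulrC].
have [x [y [Gxy rz]]] : S (r *: z).
  apply: vsubspace_biorthogonal sS _ => w hw.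
  suff -> : w = 0 by rewrite dotp0r.
  (* A [w] orthogonal to the range of [r + G] makes [(w, r w)] monotonically
     related to [G], hence a member of [G], so [2 r w] is in that range and [w = 0]. *)
  have Gw : G (w, r *: w).
    apply: (calA_max AG) => u v Guv.
    have := hw (r *: u + v) (ex_intro _ u (ex_intro _ v (conj Guv erefl))).
    have := calA_ge0 AG Guv; have : 0 <= r * dotp w w by rewrite mulr_ge0 ?dotpxx_ge0 ?ltW.
    rewrite !dotp_lin (dotpC u w) (dotpC v w); lra.
  have := hw (r *: w + r *: w) (ex_intro _ w (ex_intro _ _ (conj Gw erefl))).
  rewrite !dotp_lin -mulrDl => /eqP; rewrite mulf_eq0 gt_eqF ?addr_gt0 //=.
  by move=> /eqP/dotpxx_eq0.
by exists x; rewrite scalerBr rz addrC addKr.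
Qed.

(** The rows of [J] are resolvents of basis vectors. The [z] with [(zJ, r(z - zJ))] in [G] form a
    subspace containing the basis, hence everything. *)
Lemma calA_resolvent_matrix r G : 0 < r -> calA G ->
  exists2 J, firm J & G = resolvent_rel r J.
Proof.
move=> r0 AG; have lG := calA_linear AG; have rN0 : r != 0 by rewrite gt_eqF.
have [res hres] := choice (fun z => calA_resolvent z r0 AG).
pose J : 'M[R]_n := \matrix_(i < n) res (delta_mx 0 i).
have GJ z : G (z *m J, r *: (z - z *m J)).
  pose V := [set z | G (z *m J, r *: (z - z *m J))].
  have sV : vsubspace V.
    rewrite /V; split=> /=.
    - by rewrite mul0mx subrr scaler0; exact: linrel0.
    - move=> x y Gx Gy; have := linrelD lG Gx Gy.
      by rewrite -mulmxDl -scalerDr addrACA -opprD -mulmxDl.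
    - move=> a x Gx; have := linrelZ lG a Gx.
      by rewrite scalerA mulrC -scalerA scalerBr scalemxAl.
  have -> : z = z *m 1%:M by rewrite mulmx1.
  apply: (vsubspace_mulmx sV) => i; rewrite /V /= row1 -rowE rowK; exact: hres.
have GE x y : G (x, y) -> x = (x + r^-1 *: y) *m J.
  move=> Gxy; set z := x + r^-1 *: y.
  have yE : y = r *: (z - x) by rewrite /z addrC addKr scalerA divff // scale1r.
  have := calA_mono AG Gxy (GJ z).
  by rewrite {1}yE => /(resolvent_unique r0).
exists J.
  split.
    apply/matrixP => i j; rewrite mxE.
    (* Symmetry of [G] on these pairs leaves [J i j = J j i] once the common inner product of rows
       [i] and [j] cancels. *)
    have := calA_sym AG (GJ (delta_mx 0 i)) (GJ (delta_mx 0 j)).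
    rewrite !dotpZr => /(mulfI rN0); rewrite !dotpDr !dotpNr !dotp_delta -!rowE !mxE.
    by rewrite (dotpC (row j J)) => /addIr.
  move=> z; have := calA_ge0 AG (GJ z); rewrite dotpZr pmulr_rge0 // dotpDr dotpNr; lra.
apply/seteqP; split=> -[x y]; first exact: GE.
by move=> /(resolvent_relE _ _ _ rN0)[z [-> ->]].
Qed.

Definition envelope r J c x := r / 2 * dotp x (x - x *m J) + c.

Lemma moreau_qA r J c x : 0 < r -> firm J ->
  moreau r (fun x => qA (resolvent_rel r J) x + c%:E)%E x = (envelope r J c x)%:E.
Proof.
move=> r0 fJ; have rN0 : r != 0 by rewrite gt_eqF.
have AG := calA_resolvent_rel r0 fJ.
set u := x *m J; set v := r *: (x - u).
have Guv : resolvent_rel r J (u, v) by apply/resolvent_relE => //; exists x.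
rewrite /moreau /envelope -/u; apply/eqP; rewrite eq_le; apply/andP; split.
  apply: ereal_inf_lbound; exists u => //.
  rewrite (qA_in AG Guv) -!EFinD; congr (_%:E).
  rewrite sqr_enorm /v !dotp_lin (dotpC u x); lra.
apply: le_ereal_inf_tmp => _ [y _ <-].
have Gy := qA_ge_affine y AG Guv.
apply: le_trans (leeD (leeD Gy (lexx c%:E)) (lexx _)).
rewrite -!EFinD lee_fin sqr_enorm /v.
(* This is [r/2 |y - u|^2], the gap between the lower bound at [y] and the value attained at [u]. *)
have : 0 <= r / 2 * dotp (y - x + (x - u)) (y - x + (x - u)).
  by rewrite mulr_ge0 ?dotpxx_ge0 // divr_ge0 ?ltW.
rewrite !dotp_lin (dotpC x y) (dotpC u x) (dotpC u y); lra.
Qed.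

Lemma U_setP r (f : 'rV[R]_n -> \bar R) : 0 < r -> U_set f <->
  exists J c, firm J /\ f = (fun x => qA (resolvent_rel r J) x + c%:E)%E.
Proof.
move=> r0; split=> [[G [c [AG -> _]]]|[J [c [fJ ->]]]].
  by have [J fJ ->] := calA_resolvent_matrix r0 AG; exists J, c.
by apply: U_set_qA; exact: calA_resolvent_rel.
Qed.

End Resolvents.

(** * Series with weights [2^-i] *)

Section DyadicSeries.
Context {R : realType}.
Implicit Types a b : nat -> R.

Definition dyadic_sum a (N : nat) : R := \sum_(1 <= i < N) (2%:R ^- i * a i).

Lemma dyadic_sum_sqr N : dyadic_sum (fun i => i%:R ^+ 2) N <= 6.
Proof.
(* Telescoping: [i^2 / 2^i = p(i-1) / 2^(i-1) - p(i) / 2^i] with [p(m) = m^2 + 4 m + 6]. *)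
have E M : dyadic_sum (fun i => i%:R ^+ 2) M.+1 =
    6 - 2%:R ^- M * (M%:R ^+ 2 + 4 * M%:R + 6).
  elim: M => [|M IH]; first by rewrite /dyadic_sum big_geq // expr0 invr1; ring.
  rewrite /dyadic_sum big_nat_recr //= -/(dyadic_sum _ _) IH.
  have -> : 2%:R ^- M.+1 = 2^-1 * 2%:R ^- M :> R by rewrite (exprS _ M) invfM.
  by rewrite -natr1; lra.
case: N => [|N]; first by rewrite /dyadic_sum big_geq.
rewrite E gerBl mulr_ge0 ?invr_ge0 ?exprn_ge0 //.
Qed.

Lemma dyadic_sum_le a b N : (forall i, (0 < i)%N -> a i <= b i) ->
  dyadic_sum a N <= dyadic_sum b N.
Proof.
move=> ab; rewrite /dyadic_sum big_nat_cond [leRHS]big_nat_cond.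
apply: ler_sum => i /andP[/andP[i0 _] _].
by rewrite ler_wpM2l ?invr_ge0 ?exprn_ge0 // ab.
Qed.

(** Quadratic growth in [i] is what differences of quadratic envelopes show on the ball of radius
    [i]. *)
Lemma dyadic_sum_quadratic a (d : R) N :
  (forall i, (0 < i)%N -> a i <= i%:R ^+ 2 * d) -> 0 <= d ->
  dyadic_sum a N <= 6 * d.
Proof.
move=> ad d0; apply: (le_trans (dyadic_sum_le N ad)).
rewrite /dyadic_sum; under eq_bigr do rewrite mulrA.
by rewrite -mulr_suml ler_wpM2r // dyadic_sum_sqr.
Qed.

Lemma dyadic_sum_nondecreasing a : (forall i, 0 <= a i) ->
  {homo dyadic_sum a : N M / (N <= M)%N >-> N <= M}.
Proof.
move=> a0; apply: homo_leq => //; first exact: le_trans.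
move=> [|N]; first by rewrite /dyadic_sum !big_geq.
by rewrite /dyadic_sum [leRHS]big_nat_recr //= lerDl mulr_ge0 // invr_ge0 exprn_ge0.
Qed.

Lemma dyadic_sum_cvg a : (forall i, 0 <= a i <= 1) -> cvgn (dyadic_sum a).
Proof.
move=> a01; apply: nondecreasing_is_cvgn.
  by apply: dyadic_sum_nondecreasing => i; case/andP: (a01 i).
exists (6 * 1) => _ [N _ <-]; apply: dyadic_sum_quadratic => // i i0.
case/andP: (a01 i) => _ /le_trans; apply; rewrite mulr1 exprn_ege1 //.
by rewrite ler1n.
Qed.

Lemma dyadic_sum_term a i : (forall i, 0 <= a i <= 1) -> (0 < i)%N ->
  2%:R ^- i * a i <= limn (dyadic_sum a).
Proof.
move=> a01 i0; have a0 j : 0 <= a j by case/andP: (a01 j).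
(* The upper end of the sum is excluded, so term [i] first appears at [i.+1]. *)
apply: le_trans (nondecreasing_cvgn_le (dyadic_sum_nondecreasing a0) (dyadic_sum_cvg a01) i.+1).
rewrite /dyadic_sum big_nat_recr //= lerDr; apply: sumr_ge0 => j _.
by rewrite mulr_ge0 // invr_ge0 exprn_ge0.
Qed.

End DyadicSeries.

(** * The distance compared with the parameters [J] and [c] *)

Section Metric.
Context {R : realType} {n : nat}.
Implicit Types (f g h : 'rV[R]_n -> \bar R) (x : 'rV[R]_n) (c r : R) (J D : 'M[R]_n).

Lemma ratio01 (s : \bar R) : (0 <= s)%E -> 0 <= Defs.ratio s <= 1.
Proof.
case: s => [v| |] //=; rewrite ?lee_fin => v0; last by rewrite lexx ler01.
by rewrite divr_ge0 ?addr_ge0 //= ler_pdivrMr ?mul1r; lra.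
Qed.

Lemma ratio_le_fin (s : \bar R) (v : R) : (0 <= s)%E -> (s <= v%:E)%E -> Defs.ratio s <= v.
Proof.
case: s => [w| |] //=; rewrite !lee_fin => w0 wv; apply: le_trans wv.
rewrite ler_pdivrMr; nra.
Qed.

(** [v / (1 + v) = 1 - 1 / (1 + v)] is increasing and subadditive for [v >= 0]; if [t] or [u] is
    infinite, the right side is at least 1. *)
Lemma ratio_triangle (s t u : \bar R) : (0 <= s)%E -> (0 <= t)%E -> (0 <= u)%E ->
  (s <= t + u)%E -> Defs.ratio s <= Defs.ratio t + Defs.ratio u.
Proof.
move=> s0 t0 u0; case/andP: (ratio01 s0) (ratio01 t0) (ratio01 u0) => _ s1.
move=> /andP[rt0 _] /andP[ru0 _].
case: t t0 rt0 => [b| |] //= b0 rb0; last by rewrite ?lee_fin; lra.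
case: u u0 ru0 => [d| |] //= d0 rd0; last by rewrite ?lee_fin; lra.
case: s s0 s1 => [a| |] //=; rewrite ?lee_fin => a0 _ abd.
rewrite !lee_fin in b0 d0.
have E (v : R) : 0 <= v -> v / (1 + v) = 1 - (1 + v)^-1.
  by move=> v0; field; lra.
have : a / (1 + a) <= (b + d) / (1 + (b + d)).
  by rewrite !E ?addr_ge0 // lerD2l lerN2 lef_pV2 ?posrE; lra.
move=> /le_trans; apply; rewrite mulrDl; apply: lerD.
  by rewrite ler_wpM2l // lef_pV2 ?posrE; lra.
by rewrite ler_wpM2l // lef_pV2 ?posrE; lra.
Qed.

Lemma sup_dist_ge0 r f g i : (0 <= sup_dist r f g i)%E.
Proof.
apply: le_trans (ereal_sup_ubound _); last first.
  by exists 0 => //=; rewrite enorm0.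
exact: abse_ge0.
Qed.

Lemma sup_distC r f g i : 0 < r -> U_set f -> U_set g ->
  sup_dist r f g i = sup_dist r g f i.
Proof.
move=> r0 /(U_setP _ r0)[J [c [fJ ->]]] /(U_setP _ r0)[K [d [fK ->]]].
congr ereal_sup; apply: eq_imagel => x _.
by rewrite !moreau_qA // -!EFinB !abse_EFin distrC.
Qed.

Lemma sup_dist_triangle r f g h i : 0 < r -> U_set f -> U_set g -> U_set h ->
  (sup_dist r f h i <= sup_dist r f g i + sup_dist r g h i)%E.
Proof.
move=> r0 /(U_setP _ r0)[J [c [fJ ->]]] /(U_setP _ r0)[K [d [fK ->]]].
move=> /(U_setP _ r0)[L [e [fL ->]]].
apply: ge_ereal_sup => _ [x xi <-].
apply: le_trans (leeD (ereal_sup_ubound _) (ereal_sup_ubound _)); last 2 first.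
- by exists x.
- by exists x.
rewrite !moreau_qA // -!EFinB !abse_EFin -EFinD lee_fin.
exact: ler_distD.
Qed.

Definition mxsum_norm D := \sum_i \sum_j `|D i j|.

Lemma dotp_mx_le D x : `|dotp x (x *m D)| <= enorm x ^+ 2 * mxsum_norm D.
Proof.
rewrite expr2 -mulrA; apply: le_trans (dotp_le_enorm _ _) _.
rewrite ler_wpM2l ?sqrtr_ge0 // /mxsum_norm exchange_big /= mulr_sumr.
apply: ler_sum => j _; rewrite mxE mulr_sumr.
apply: le_trans (ler_norm_sum _ _ _) _; apply: ler_sum => i _.
by rewrite normrM ler_wpM2r // enorm_coord.
Qed.

Lemma envelopeB r J K c d x :
  envelope r J c x - envelope r K d x = r / 2 * dotp x (x *m (K - J)) + (c - d).
Proof. by rewrite /envelope mulmxBr !dotp_lin; ring. Qed.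

(** The quadratic part scales with the squared radius; [i >= 1] lets the constant part share the
    factor [i^2]. *)
Lemma sup_dist_le r J K c d i : 0 < r -> firm J -> firm K -> (0 < i)%N ->
  (sup_dist r (fun x => qA (resolvent_rel r J) x + c%:E)
    (fun x => qA (resolvent_rel r K) x + d%:E) i <=
    (i%:R ^+ 2 * (r / 2 * mxsum_norm (K - J) + `|c - d|))%:E)%E.
Proof.
move=> r0 fJ fK i0; apply: ge_ereal_sup => _ [x /= xi <-].
rewrite !moreau_qA // -EFinB abse_EFin lee_fin envelopeB.
apply: le_trans (ler_normD _ _) _; rewrite mulrDr; apply: lerD; last first.
  by rewrite ler_peMl // exprn_ege1 // ler1n.
have r2 : 0 <= r / 2 by rewrite divr_ge0 // ltW.
rewrite normrM (ger0_norm r2) mulrCA ler_wpM2l //.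
apply: le_trans (dotp_mx_le _ _) _; apply: ler_wpM2r.
  by apply: sumr_ge0 => ? _; apply: sumr_ge0.
by rewrite ler_pXn2r // ?nnegrE ?sqrtr_ge0.
Qed.

(** The point 0 isolates [c - d]. Removing it bounds the quadratic part by [4 / r * s], and three
    such terms, halved by polarization, give [6 / r * s]. *)
Lemma sup_dist_ge r J K c d (s : R) : 0 < r -> firm J -> firm K ->
  sup_dist r (fun x => qA (resolvent_rel r J) x + c%:E)%E
    (fun x => qA (resolvent_rel r K) x + d%:E)%E 2 = s%:E ->
  `|c - d| <= s /\ forall i j, `|J i j - K i j| <= 6 / r * s.
Proof.
move=> r0 fJ fK sE.
have bnd x : enorm x <= 2 -> `|envelope r J c x - envelope r K d x| <= s.
  move=> x2; rewrite -lee_fin -sE; apply: ereal_sup_ubound; exists x => //.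
  by rewrite !moreau_qA.
have cd : `|c - d| <= s.
  by have := bnd 0; rewrite enorm0 envelopeB dotp0l mulr0 add0r; apply.
split=> // i j.
pose q x := dotp x (x *m (K - J)).
have qs x : enorm x <= 2 -> `|q x| <= 4 / r * s.
  move=> /bnd; rewrite envelopeB -/(q x) => h.
  have : `|r / 2 * q x| <= s + s.
    rewrite -[r / 2 * q x](addrK (c - d)); apply: le_trans (ler_normB _ _) _.
    exact: lerD.
  rewrite normrM gtr0_norm ?divr_gt0 // => h2.
  rewrite -[`|q x|](mulKf (_ : r / 2 != 0)); last by rewrite gt_eqF ?divr_gt0.
  rewrite (_ : 4 / r * s = (r / 2)^-1 * (s + s)); last by field; rewrite gt_eqF.
  by rewrite ler_pM2l ?invr_gt0 ?divr_gt0.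
have sD : (K - J)^T = K - J by case: fJ fK => sJ _ [sK _]; rewrite raddfB /= sJ sK.
pose ei : 'rV[R]_n := delta_mx 0 i; pose ej : 'rV[R]_n := delta_mx 0 j.
(* Polarization; the ball of radius 2 contains all [ei + ej]. *)
have pol : 2 * (K - J) i j = q (ei + ej) - q ei - q ej.
  have ij : dotp ej (ei *m (K - J)) = (K - J) i j.
    by rewrite dotpC dotp_delta -rowE mxE.
  have ji : dotp ei (ej *m (K - J)) = (K - J) i j by rewrite dotpC dotp_mulmx sD.
  by rewrite /q mulmxDl !(dotpDl, dotpDr) ij ji; ring.
have nei (k : 'I_n) : dotp (delta_mx 0 k) (delta_mx 0 k) = 1 :> R.
  by rewrite dotp_delta mxE !eqxx.
have e1 (k : 'I_n) : enorm (delta_mx 0 k : 'rV[R]_n) <= 2.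
  by rewrite /enorm nei sqrtr1; lra.
have e2 : enorm (ei + ej) <= 2.
  have -> : 2 = Num.sqrt (2 ^+ 2) :> R by rewrite sqrtr_sqr ger0_norm.
  rewrite /enorm; apply: ler_wsqrtr; rewrite !dotp_lin !nei (dotpC ej ei).
  have : dotp ei ej <= 1 by rewrite dotp_delta mxE eqxx /=; case: (_ == _) => /=; lra.
  lra.
have := qs _ e2; have := qs _ (e1 i); have := qs _ (e1 j); rewrite -/ei -/ej.
move=> h1 h2 h3.
have : `|2 * (K - J) i j| <= 4 / r * s + 4 / r * s + 4 / r * s.
  rewrite pol; apply: le_trans (ler_normB _ _) _; apply: lerD => //.
  by apply: le_trans (ler_normB _ _) _; apply: lerD.
rewrite normrM ger0_norm // !mxE distrC; lra.
Qed.

Lemma aw_distE r f g : aw_dist r f g = limn (dyadic_sum (fun i => Defs.ratio (sup_dist r f g i))).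
Proof. by []. Qed.

Lemma ratio_sup_dist01 r f g i : 0 <= Defs.ratio (sup_dist r f g i) <= 1.
Proof. exact/ratio01/sup_dist_ge0. Qed.

Lemma aw_dist_ge0 r f g : 0 <= aw_dist r f g.
Proof.
apply: le_trans (dyadic_sum_term (ratio_sup_dist01 r f g) (ltn0Sn 0)).
by rewrite mulr_ge0 ?invr_ge0 ?exprn_ge0 //; case/andP: (ratio_sup_dist01 r f g 1).
Qed.

Lemma aw_dist_triangle r f g h : 0 < r -> U_set f -> U_set g -> U_set h ->
  aw_dist r f h <= aw_dist r f g + aw_dist r g h.
Proof.
move=> r0 Uf Ug Uh; rewrite !aw_distE.
set a := (X in limn (dyadic_sum X) <= _).
set b := (X in _ <= limn (dyadic_sum X) + _).
set c := (X in _ <= _ + limn (dyadic_sum X)).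
have ca : dyadic_sum a @ \oo --> limn (dyadic_sum a).
  exact: (dyadic_sum_cvg (ratio_sup_dist01 r f h)).
have cb : dyadic_sum b @ \oo --> limn (dyadic_sum b).
  exact: (dyadic_sum_cvg (ratio_sup_dist01 r f g)).
have cc : dyadic_sum c @ \oo --> limn (dyadic_sum c).
  exact: (dyadic_sum_cvg (ratio_sup_dist01 r g h)).
apply: (ler_cvg_to ca (cvgD cb cc)); apply: nearW => N.
change (dyadic_sum a N <= dyadic_sum b N + dyadic_sum c N).
have -> : dyadic_sum b N + dyadic_sum c N = dyadic_sum (fun i => b i + c i) N.
  by rewrite /dyadic_sum -big_split; apply: eq_bigr => i _; rewrite mulrDr.
apply: dyadic_sum_le => i _; apply: ratio_triangle; rewrite ?sup_dist_ge0 //.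
exact: sup_dist_triangle.
Qed.

Lemma aw_dist_le r J K c d : 0 < r -> firm J -> firm K ->
  aw_dist r (fun x => qA (resolvent_rel r J) x + c%:E)%E
    (fun x => qA (resolvent_rel r K) x + d%:E)%E <=
  6 * (r / 2 * mxsum_norm (K - J) + `|c - d|).
Proof.
move=> r0 fJ fK; rewrite aw_distE; apply: limr_le.
  exact: dyadic_sum_cvg (ratio_sup_dist01 _ _ _).
apply: nearW => N; apply: dyadic_sum_quadratic => [i i0|].
  by apply: ratio_le_fin; [exact: sup_dist_ge0|exact: sup_dist_le].
rewrite addr_ge0 // mulr_ge0 ?divr_ge0 ?(ltW r0) //.
by apply: sumr_ge0 => ? _; apply: sumr_ge0.
Qed.

(** Only the term [i = 2], of weight 1/4, is used: its ratio is at most [4 * a <= 1/2]. This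
    excludes an infinite supremum, whose ratio is 1, and forces [s <= 1], so
    [s <= 4 * a * (1 + s) <= 8 * a]; then [48 = 6 * 8]. *)
Lemma aw_dist_ge r J K c d : 0 < r -> firm J -> firm K ->
  let a := aw_dist r (fun x => qA (resolvent_rel r J) x + c%:E)%E
    (fun x => qA (resolvent_rel r K) x + d%:E)%E in
  a <= 1 / 8 ->
  `|c - d| <= 8 * a /\ forall i j, `|J i j - K i j| <= 48 / r * a.
Proof.
move=> r0 fJ fK a a8.
pose f := (fun x => qA (resolvent_rel r J) x + c%:E)%E.
pose g := (fun x => qA (resolvent_rel r K) x + d%:E)%E.
have := dyadic_sum_term (ratio_sup_dist01 r f g) (ltn0Sn 1).
rewrite -aw_distE -[aw_dist _ _ _]/a (_ : 2%:R ^- 2 = 1 / 4); last by field.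
have := sup_dist_ge0 r f g 2.
case sE : (sup_dist r f g 2) => [s| |] //=; rewrite ?lee_fin; last first.
  by move=> _; lra.
move=> s0 h; have rs : s / (1 + s) <= 4 * a by lra.
have s8 : s <= 8 * a.
  have s1 : s <= 1.
    by have : s / (1 + s) <= 1 / 2 by [lra]; rewrite ler_pdivrMr; lra.
  by move: rs; rewrite ler_pdivrMr; [nra|lra].
have [h1 h2] := sup_dist_ge r0 fJ fK sE; split=> [|i j]; first exact: le_trans s8.
apply: le_trans (h2 i j) _; rewrite (_ : 48 / r * a = 6 / r * (8 * a)); last by ring.
by rewrite ler_wpM2l // divr_ge0 // ltW.
Qed.

Lemma aw_dist_eq0 r f g : 0 < r -> U_set f -> U_set g ->
  aw_dist r f g = 0 <-> f = g.
Proof.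
move=> r0 /(U_setP _ r0)[J [c [fJ ->]]] /(U_setP _ r0)[K [d [fK ->]]].
split=> [a0|->].
  have := @aw_dist_ge r J K c d r0 fJ fK; rewrite /= a0 !mulr0 => -[|cd JK]; first by lra.
  have -> : c = d by apply/eqP; rewrite -subr_eq0 -normr_le0.
  suff -> : J = K by [].
  by apply/matrixP => i j; apply/eqP; rewrite -subr_eq0 -normr_le0.
apply/eqP; rewrite eq_le aw_dist_ge0 andbT.
apply: le_trans (aw_dist_le _ _ r0 fK fK) _.
rewrite !subrr normr0 addr0 /mxsum_norm big1 ?mulr0 // => i _.
by rewrite big1 // => j _; rewrite mxE normr0.
Qed.

End Metric.

(** * Completeness through convergence of the parameters *)

Section Completeness.
Context {R : realType} {n : nat}.

Lemma real_cauchy_cvg (v : nat -> R) :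
  (forall e : R, 0 < e -> exists N, forall k m, (N <= k)%N -> (N <= m)%N ->
     `|v k - v m| < e) ->
  exists l : R, v @ \oo --> l.
Proof.
move=> h; suff : cvgn v by move=> cv; exists (limn v).
apply: cauchy_cvg; apply: cauchy_exP => e e0; have [N hN] := h e e0.
by exists (v N); exists N => // k /= Nk; rewrite /ball /=; apply: hN.
Qed.

Lemma cvg_sumr (I : finType) (v : I -> nat -> R) (l : I -> R) :
  (forall i, v i @ \oo --> l i) -> (fun k => \sum_i v i k) @ \oo --> \sum_i l i.
Proof. by move=> h; apply: cvg_big => //; exact: add_continuous. Qed.

Lemma cvg_dotp (x y : nat -> 'rV[R]_n) (a b : 'rV[R]_n) :
  (forall i, (fun k => x k 0 i) @ \oo --> a 0 i) ->
  (forall i, (fun k => y k 0 i) @ \oo --> b 0 i) ->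
  (fun k => dotp (x k) (y k)) @ \oo --> dotp a b.
Proof. by move=> xa yb; apply: cvg_sumr => i; apply: cvgM. Qed.

Lemma firm_closed (J : nat -> 'M[R]_n) (L : 'M[R]_n) :
  (forall k, firm (J k)) -> (forall i j, (fun k => J k i j) @ \oo --> L i j) ->
  firm L.
Proof.
move=> fJ JL; split.
  apply/matrixP => i j; rewrite mxE; have Lji := JL j i.
  have E : (fun k => J k j i) = (fun k => J k i j).
    by apply/funext => k; case: (fJ k) => sJ _; rewrite -{1}sJ mxE.
  by rewrite E in Lji; exact: (cvg_unique _ Lji (JL i j)).
move=> z; have zJ i : (fun k => (z *m J k) 0 i) @ \oo --> (z *m L) 0 i.
  have -> : (fun k => (z *m J k) 0 i) = (fun k => \sum_j z 0 j * J k j i).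
    by apply/funext => k; rewrite mxE.
  rewrite mxE; apply: cvg_sumr => j; apply: cvgM; last exact: JL.
  exact: cvg_cst.
have zz i : (fun _ : nat => z 0 i) @ \oo --> z 0 i by exact: cvg_cst.
apply: (ler_cvg_to (cvg_dotp zJ zJ) (cvg_dotp zJ zz)).
by apply: nearW => k; case: (fJ k) => _.
Qed.

Lemma aw_complete (r : R) (u : nat -> ('rV[R]_n -> \bar R)) : 0 < r ->
  (forall k, U_set (u k)) ->
  (forall e : R, 0 < e -> exists N : nat, forall k m : nat,
     (N <= k)%N -> (N <= m)%N -> aw_dist r (u k) (u m) < e) ->
  exists2 f, U_set f & (fun k => aw_dist r (u k) f) @ \oo --> (0 : R^o).
Proof.
move=> r0 Uu cu.
have Uq k : exists q : 'M[R]_n * R, firm q.1 /\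
    u k = (fun x => qA (resolvent_rel r q.1) x + q.2%:E)%E.
  by have /(U_setP _ r0)[J [c h]] := Uu k; exists (J, c).
have [p hp] := choice Uq.
pose J k := (p k).1; pose c k := (p k).2.
have fJ k : firm (J k) by case: (hp k).
have uE k : u k = (fun x => qA (resolvent_rel r (J k)) x + (c k)%:E)%E by case: (hp k).
have cauchy_of (v : nat -> R) (C : R) : 0 < C ->
    (forall k m, aw_dist r (u k) (u m) <= 1 / 8 ->
      `|v k - v m| <= C * aw_dist r (u k) (u m)) -> exists l : R, v @ \oo --> l.
  move=> C0 hv; apply: real_cauchy_cvg => e e0.
  (* The bound [1 / 8] makes the lower estimate of the distance applicable; [e / C] absorbs its
     constant. *)
  have [|N hN] := cu (Num.min (1 / 8) (e / C)).
    by rewrite lt_min !divr_gt0.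
  exists N => k m Nk Nm; have := hN k m Nk Nm; rewrite lt_min => /andP[h8 he].
  apply: le_lt_trans (hv k m (ltW h8)) _.
  by rewrite -ltr_pdivlMl // mulrC.
have [d cd] : exists d : R, c @ \oo --> d.
  apply: (@cauchy_of _ 8) => // k m; rewrite !uE => h.
  by case: (aw_dist_ge r0 (fJ k) (fJ m) h).
have JL' (q : 'I_n * 'I_n) : exists l : R, (fun k => J k q.1 q.2) @ \oo --> l.
  apply: (@cauchy_of _ (48 / r)); first by rewrite divr_gt0.
  by move=> k m; rewrite !uE => h; case: (aw_dist_ge r0 (fJ k) (fJ m) h).
have [l hl] := choice JL'.
pose L : 'M[R]_n := \matrix_(i, j) l (i, j).
have JL i j : (fun k => J k i j) @ \oo --> L i j.
  by rewrite mxE; exact: (hl (i, j)).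
have fL := firm_closed fJ JL.
exists (fun x => qA (resolvent_rel r L) x + d%:E)%E.
  by apply/(U_setP _ r0); exists L, d.
(* The distance to the candidate limit lies between 0 and the bound of [aw_dist_le], which tends to
   0 with the parameters. *)
apply: (@squeeze_cvgr _ _ _ _ (fun=> 0)
  (fun k => 6 * (r / 2 * mxsum_norm (L - J k) + `|c k - d|))).
- by apply: nearW => k; rewrite aw_dist_ge0 uE aw_dist_le.
- exact: cvg_cst.
have N0 : (fun k => mxsum_norm (L - J k)) @ \oo --> (0 : R).
  have -> : (0 : R) = \sum_(i < n) \sum_(j < n) 0.
    by rewrite big1 // => i _; rewrite big1.
  apply: cvg_sumr => i; apply: cvg_sumr => j.
  have -> : (fun k => `|(L - J k) i j|) = (fun k => `|L i j - J k i j|).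
    by apply/funext => k; rewrite !mxE.
  rewrite -(normr0 R) -(subrr (L i j)); apply: cvg_norm; apply: cvgB => //.
  exact: cvg_cst.
have c0 : (fun k => `|c k - d|) @ \oo --> (0 : R).
  by rewrite -(normr0 R) -(subrr d); apply: cvg_norm; apply: cvgB => //; exact: cvg_cst.
have -> : 0 = 6 * (r / 2 * 0 + 0) :> R by rewrite mulr0 addr0 mulr0.
apply: cvgM; first exact: cvg_cst.
apply: cvgD => //; apply: cvgM => //; exact: cvg_cst.
Qed.

End Completeness.

Theorem theorem5p9 (R : realType) (n : nat) (r : R) (hr : 0 < r) :
  (* (i) (U, d) is a complete metric space *)
  ([/\ (forall f g : 'rV[R]_n -> \bar R, U_set f -> U_set g -> 0 <= aw_dist r f g),
       (forall f g : 'rV[R]_n -> \bar R, U_set f -> U_set g ->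
          (aw_dist r f g = 0 <-> f = g)),
       (forall f g : 'rV[R]_n -> \bar R, U_set f -> U_set g ->
          aw_dist r f g = aw_dist r g f),
       (forall f g h : 'rV[R]_n -> \bar R, U_set f -> U_set g -> U_set h ->
          aw_dist r f h <= aw_dist r f g + aw_dist r g h) &
       (forall u : nat -> ('rV[R]_n -> \bar R), (forall k, U_set (u k)) ->
          (forall e : R, 0 < e -> exists N : nat, forall k m : nat,
             (N <= k)%N -> (N <= m)%N -> aw_dist r (u k) (u m) < e) ->
          exists2 f, U_set f & (fun k => aw_dist r (u k) f) @ \oo --> (0 : R^o))]) /\
  (* (ii) *)
  (forall f : 'rV[R]_n -> \bar R, U_set f -> U_set (fconj f)) /\
  (* (iii) *)
  (forall (f : 'rV[R]_n -> \bar R) (l : R), U_set f -> 0 < l -> U_set (fscale l f)) /\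
  (* (iv) *)
  (forall f1 f2 : 'rV[R]_n -> \bar R, U_set f1 -> U_set f2 -> U_set (fadd f1 f2)) /\
  (* (v) *)
  (forall f1 f2 : 'rV[R]_n -> \bar R, U_set f1 -> U_set f2 -> U_set (infconv f1 f2)).
Proof.
split; first split.
- by move=> f g _ _; exact: aw_dist_ge0.
- by move=> f g; exact: aw_dist_eq0.
- move=> f g Uf Ug; rewrite !aw_distE; congr (limn (dyadic_sum _)).
  by apply/funext => i; rewrite sup_distC.
- by move=> f g h; exact: aw_dist_triangle.
- by move=> u; exact: aw_complete.
split; first by move=> _ [G [c [AG -> _]]]; rewrite fconj_qA //; apply/U_set_qA/calA_inv.
split.
  move=> _ l [G [c [AG -> _]]] l0; rewrite fscale_qA //.
  by apply: U_set_qA; exact: calA_scale.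
split=> _ _ [G [c [AG -> _]]] [H [d [AH -> _]]].
  by rewrite fadd_qA //; apply: U_set_qA; exact: calA_add.
by rewrite infconv_qA //; apply: U_set_qA; exact: calA_parallel.
Qed.
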